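(* Let $\kappa$ be a cardinal with $\aleph_0\leq\kappa<2^{\aleph_0}$. The following statement (4) is equivalent to each of the statements (1), (2), (3) below. (1) $MA(\kappa)$: for each non-empty compact space $X$ with the ccc, if $(U_\alpha:\alpha<\kappa)$ is a family of open dense subsets of $X$, then $\bigcap\{U_\alpha:\alpha<\kappa\}\neq\emptyset$. (2) For each space $X$ with the ccc such that $\{x\in X: x \text{ has a compact neighborhood}\}$ is dense in $X$, if $(U_\alpha:\alpha<\kappa)$ is a family of open dense subsets of $X$, then $\bigcap\{U_\alpha:\alpha<\kappa\}$ is a dense subset of $X$. (3) For each poset $(\mathbb{P},\leq,1)$ with the ccc, if $\mathcal{D}$ is a family of dense subsets of $\mathbb{P}$ with $|\mathcal{D}|\leq\kappa$, then there exists a filter $G\subseteq\mathbb{P}$ such that $D\cap G\neq\emptyset$ for every $D\in\mathcal{D}$. (4) For each non-empty quasiregular H-closed space $X$ with the ccc, if $(U_\alpha:\alpha<\kappa)$ is a family of open dense subsets of $X$, then $\bigcap\{U_\alpha:\alpha<\kappa\}\neq\emptyset$.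
   Context: All spaces are Hausdorff topological spaces. A space $X$ is quasiregular if for every non-empty open set $U\subseteq X$ there is a non-empty open set $V\subseteq X$ with $\overline{V}\subseteq U$. A space $X$ is H-closed if it is Hausdorff and closed in every Hausdorff space in which it is embedded; equivalently, $X$ is Hausdorff and every open cover $\mathcal{U}$ of $X$ has a finite subfamily $\mathcal{V}\subseteq\mathcal{U}$ with $\overline{\bigcup\mathcal{V}}=X$. A space has the ccc if every family of pairwise disjoint non-empty open subsets is countable. A poset $(\mathbb{P},\leq,1)$ has a maximum element $1$. A subset $D\subseteq\mathbb{P}$ is dense if for every $p\in\mathbb{P}$ there is $d\in D$ with $d\leq p$. Elements $p,q\in\mathbb{P}$ are compatible if there is $r\in\mathbb{P}$ with $r\leq p$ and $r\leq q$, and incompatible otherwise. The poset has the ccc if every antichain (subset whose elements are pairwise incompatible) is countable. A subset $G\subseteq\mathbb{P}$ is a filter if (a) $1\in G$; (b) for every $p,q\in G$ there is $r\in G$ with $r\leq p$ and $r\leq q$; (c) for all $p,q\in\mathbb{P}$, if $p\in G$ and $p\leq q$, then $q\in G$. *)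

(* Defs.v *)
From HB Require Import structures.
From mathcomp Require Import all_boot all_order.
From mathcomp Require Import boolp classical_sets functions cardinality topology.

Set Implicit Arguments.
Unset Strict Implicit.
Unset Printing Implicit Defensive.

Local Open Scope classical_set_scope.
Local Open Scope card_scope.

Definition card_lt (S T : Type) (A : set S) (B : set T) : Prop :=
  A #<= B /\ ~ (A #= B).

Definition quasiregular (X : topologicalType) : Prop :=
  forall U : set X, open U -> U !=set0 ->
    exists V : set X, [/\ open V, V !=set0 & closure V `<=` U].

(* a homeomorphism onto the subspace [range f] *)
Definition embedding (X Y : topologicalType) (f : X -> Y) : Prop :=
  [/\ injective f,
      continuous f &
      forall U : set X, open U ->
        exists2 V : set Y, open V & f @` U = V `&` range f].

Definition H_closed (X : topologicalType) : Prop :=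
  hausdorff_space X /\
  forall (Y : topologicalType) (f : X -> Y),
    hausdorff_space Y -> embedding f -> closed (range f).

Definition ccc_space (X : topologicalType) : Prop :=
  forall F : set (set X),
    (forall U, F U -> open U /\ U !=set0) -> trivIset F id -> countable F.

Definition has_compact_nbhd (X : topologicalType) (x : X) : Prop :=
  exists2 N : set X, nbhs x N & compact N.

Section ForcingPosets.
Context {d : Order.disp_t} {P : tPOrderType d}.
Local Open Scope order_scope.

Definition poset_dense (D : set P) : Prop :=
  forall p : P, exists2 e : P, D e & e <= p.

Definition compatible (p q : P) : Prop :=
  exists r : P, r <= p /\ r <= q.

Definition antichain (A : set P) : Prop :=
  forall p q : P, A p -> A q -> p <> q -> ~ compatible p q.

Definition poset_filter (G : set P) : Prop :=
  [/\ G \top,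
      (forall p q : P, G p -> G q -> exists r : P, [/\ G r, r <= p & r <= q]) &
      (forall p q : P, G p -> p <= q -> G q)].

End ForcingPosets.

Definition ccc_poset (d : Order.disp_t) (P : tPOrderType d) : Prop :=
  forall A : set P, antichain A -> countable A.

(* In the four statements below the cardinal kappa is the cardinality of the
   type [K], and families indexed by kappa are indexed by [K]. *)

Definition MA_compact (K : Type) : Prop :=
  forall X : topologicalType,
    hausdorff_space X -> [set: X] !=set0 -> compact [set: X] -> ccc_space X ->
    forall U : K -> set X,
      (forall a, open (U a) /\ dense (U a)) ->
      \bigcap_(a in [set: K]) U a !=set0.

Definition MA_dense_compact_nbhd (K : Type) : Prop :=
  forall X : topologicalType,
    hausdorff_space X -> ccc_space X -> dense [set x : X | has_compact_nbhd x] ->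
    forall U : K -> set X,
      (forall a, open (U a) /\ dense (U a)) ->
      dense (\bigcap_(a in [set: K]) U a).

Definition MA_poset (K : Type) : Prop :=
  forall (d : Order.disp_t) (P : tPOrderType d),
    ccc_poset P ->
    forall DD : set (set P),
      (forall D, DD D -> poset_dense D) -> DD #<= [set: K] ->
      exists G : set P,
        poset_filter G /\ forall D, DD D -> D `&` G !=set0.

Definition MA_H_closed (K : Type) : Prop :=
  forall X : topologicalType,
    [set: X] !=set0 -> quasiregular X -> H_closed X -> ccc_space X ->
    forall U : K -> set X,
      (forall a, open (U a) /\ dense (U a)) ->
      \bigcap_(a in [set: K]) U a !=set0.

(* Main.v *)
Require Import Defs.
From HB Require Import structures.
From mathcomp Require Import all_boot all_order.
From mathcomp Require Import boolp classical_sets functions cardinality topology.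

Import Order.TTheory.

Local Open Scope classical_set_scope.
Local Open Scope card_scope.
Set Implicit Arguments.
Unset Strict Implicit.
Unset Printing Implicit Defensive.

(** The three equivalences follow from five implications.

    [MA_H_closed] => [MA_compact] and [MA_dense_compact_nbhd] => [MA_compact]:
    a compact Hausdorff space is quasiregular and H-closed, and its points have
    compact neighbourhoods ([compact_quasiregular], [compact_H_closed]).

    [MA_poset] => [MA_H_closed] and [MA_poset] => [MA_dense_compact_nbhd]: both
    are instances of [MA_poset_point], which forces with the non-empty open
    subsets of an open set [W].  Two facts about [W] are used: a non-empty open
    subset of [W] contains the closure of another one, and filters with an open
    base that contain [W] have cluster points.  For quasiregular H-closed spaces,
    [W] is the whole space and the second fact is [H_closed_cluster]: an open
    filter without a cluster point would provide a Hausdorff extension of the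
    space by one point, in which it is not closed.  For spaces with a dense set of
    points having a compact neighbourhood, [W] is an open subset of a compact set.

    [MA_compact] => [MA_poset]: let [P] be a ccc poset.  The maximal filters of
    lower sets of [P] form a compact Hausdorff ccc space, the Stone space of the
    regular open algebra of [P] ([mof_hausdorff], [mof_compact], [mof_ccc]).  A
    predense subset of [P] gives a dense open subset of this space, so there is a
    point that meets [K] many prescribed predense sets.  To extract a filter on
    [P] from such a point, [MA_compact_poset] prescribes a family of maximal
    antichains indexed by the finite binary trees with leaves in [K], such that
    the antichain of a tree refines those of its subtrees.  There are only [K]
    many such trees ([card_le_tree]), because an infinite cardinal equals its
    square ([exists_pairing_function]). *)

(** * Squares of infinite cardinals, and finite trees *)

(** A maximal partial matching between [A] and [B], given by Zorn's lemma,
    exhausts one of the two sides. *)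
Lemma card_le_total (T U : Type) (A : set T) (B : set U) :
  A #<= B \/ B #<= A.
Proof.
pose matching (R : set (T * U)) :=
  [/\ forall a b, R (a, b) -> A a /\ B b,
      forall a b b', R (a, b) -> R (a, b') -> b = b' &
      forall a a' b, R (a, b) -> R (a', b) -> a = a'].
have chain F : F `<=` matching -> total_on F subset ->
    matching (\bigcup_(R in F) R).
  move=> FM Ftot; split.
  - by move=> a b [R /FM[+ _ _]]; apply.
  - move=> a b b' [R FR Rab] [S FS Sab'].
    have [RS|SR] := Ftot _ _ FR FS.
      by have [_ + _] := FM _ FS; apply; [exact: RS Rab|exact: Sab'].
    by have [_ + _] := FM _ FR; apply; [exact: Rab|exact: SR Sab'].
  - move=> a a' b [R FR Rab] [S FS Sab'].
    have [RS|SR] := Ftot _ _ FR FS.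
      by have [_ _] := FM _ FS; apply; [exact: RS Rab|exact: Sab'].
    by have [_ _] := FM _ FR; apply; [exact: Rab|exact: SR Sab'].
have [R [[RAB Rfun Rinj] Rmax]] := Zorn_bigcup chain.
have [domR|/existsNP[a /not_implyP[Aa nRa]]] :=
    pselect (forall a, A a -> exists b, R (a, b)).
  left; have /choice[f Rf] (a : A) : exists b : B, R (val a, val b).
    have [b Rab] := domR (val a) (set_mem (valP a)).
    by exists (SigSub (mem_set (RAB _ _ Rab).2)).
  apply/card_leP/injfunPex; exists f => // a a' _ _ eq_f.
  by apply/val_inj/(Rinj _ _ (val (f a))); [|rewrite eq_f].
have [ranR|/existsNP[b /not_implyP[Bb nRb]]] :=
    pselect (forall b, B b -> exists a, R (a, b)).
  right; have /choice[f Rf] (b : B) : exists a : A, R (val a, val b).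
    have [a' Rab] := ranR (val b) (set_mem (valP b)).
    by exists (SigSub (mem_set (RAB _ _ Rab).1)).
  apply/card_leP/injfunPex; exists f => // b b' _ _ eq_f.
  by apply/val_inj/(Rfun (val (f b))); [|rewrite eq_f].
(* otherwise a and b are both unmatched, and R extends by the pair (a, b) *)
exfalso; apply: (Rmax (R `|` [set (a, b)])).
  split=> [x Rx|/(_ (a, b))]; first by left.
  by move=> sub; apply: nRa; exists b; apply: sub; right.
split.
- by move=> x y [/RAB//|[-> ->]].
- move=> x y y' [Rxy|[ex ->]] [Rxy'|[ex' ->]] //; first exact: Rfun Rxy Rxy'.
    by case: nRa; exists y; rewrite -ex'.
  by case: nRa; exists y'; rewrite -ex.
- move=> x x' y [Rxy|[-> ey]] [Rxy'|[-> ey']] //; first exact: Rinj Rxy Rxy'.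
    by case: nRb; exists x; rewrite -ey'.
  by case: nRb; exists x'; rewrite -ey.
Qed.

(** A relation [R] is read as the graph of a partial binary operation, and
    [R (a, b, c)] as [a * b = c].  Graphs rather than functions are used so that
    the union of a chain makes sense; the domain is recovered from the graph as
    the set of elements whose square is defined. *)
Definition pairing_dom (T : Type) (R : set (T * T * T)) : set T :=
  [set a | exists c, R (a, a, c)].

(** [R] is the graph of an injection of [A * A] into [A], for [A] the domain. *)
Definition pairing (T : Type) (R : set (T * T * T)) : Prop :=
  [/\ forall a b c, R (a, b, c) ->
        [/\ pairing_dom R a, pairing_dom R b & pairing_dom R c],
      forall a b, pairing_dom R a -> pairing_dom R b -> exists c, R (a, b, c),
      forall a b c c', R (a, b, c) -> R (a, b, c') -> c = c' &
      forall a b a' b' c, R (a, b, c) -> R (a', b', c) -> a = a' /\ b = b'].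

Lemma pairing_domS (T : Type) (R S : set (T * T * T)) :
  R `<=` S -> pairing_dom R `<=` pairing_dom S.
Proof. by move=> RS a [c /RS]; exists c. Qed.

Lemma pairing_bigcup (T : Type) (F : set (set (T * T * T))) :
  F `<=` @pairing T -> total_on F subset -> pairing (\bigcup_(R in F) R).
Proof.
move=> FP Ftot.
have common x y : (\bigcup_(R in F) R) x -> (\bigcup_(R in F) R) y ->
    exists R, [/\ F R, R x & R y].
  move=> [R FR Rx] [S FS Sy]; have [RS|SR] := Ftot _ _ FR FS.
    by exists S; split=> //; exact: RS.
  by exists R; split=> //; exact: SR.
have sub R : F R -> R `<=` \bigcup_(R in F) R by move=> FR x; exists R.
split.
- move=> a b c [R FR]; have [Rsq _ _ _] := FP _ FR => /Rsq[Ra Rb Rc].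
  by split; apply: (pairing_domS (sub _ FR)).
- move=> a b [c ac] [d bd]; have [R [FR Rac Rbd]] := common _ _ ac bd.
  have [_ Rtot _ _] := FP _ FR.
  have [||e Rabe] := Rtot a b; [by exists c|by exists d|].
  by exists e, R.
- move=> a b c c' abc abc'; have [R [FR Rc Rc']] := common _ _ abc abc'.
  by have [_ _ Rfun _] := FP _ FR; exact: Rfun Rc Rc'.
- move=> a b a' b' c abc abc'; have [R [FR Rc Rc']] := common _ _ abc abc'.
  by have [_ _ _ Rinj] := FP _ FR; exact: Rinj Rc Rc'.
Qed.

(** The square of an infinite cardinal is itself.  Zorn's lemma gives a maximal
    injection of [A * A] into [A] that extends a pairing function on a copy of
    the natural numbers.  If the complement of [A] embeds in [A], the whole type
    does, because [A] contains two disjoint copies of itself.  Otherwise the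
    complement contains a copy [B] of [A]; then [A `|` B] embeds in [A], so the
    pairs of [A `|` B] that are not pairs of [A] can be sent injectively to [B],
    which contradicts maximality. *)
Lemma exists_pairing_function (T : Type) : [set: nat] #<= [set: T] ->
  exists f : T -> T -> T, forall a b a' b', f a b = f a' b' -> a = a' /\ b = b'.
Proof.
elim/Ppointed: T => T; first by move=> _; exists (fun a _ => a) => a;
  case: (no a).
move=> /pcard_leTP/injPex[i iinj].
have {}iinj m n : i m = i n -> m = n by apply: iinj; rewrite inE.
pose R0 : set (T * T * T) :=
  [set x | exists m n, x = (i m, i n, i (pickle (m, n)))].
have sqR0 n : pairing_dom R0 (i n) by exists (i (pickle (n, n))), n, n.
have R0P : pairing R0.
  split.
  - by move=> _ _ _ [m [n [-> -> ->]]].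
  - move=> a b [_ [m [_ [-> _ _]]]] [_ [n [_ [-> _ _]]]].
    by exists (i (pickle (m, n))), m, n.
  - move=> a b c c' [m [n [-> -> ->]]] [m' [n' [/iinj <- /iinj <- ->]]].
    by [].
  - move=> a b a' b' c [m [n [-> -> ->]]] [m' [n' [-> -> /iinj]]].
    by move/(pcan_inj pickleK) => [-> ->].
(* Zorn's lemma applies to the part of the graph to be added to R0, so that the
   empty chain has an upper bound and every candidate is infinite. *)
have chain F : F `<=` [set R | pairing (R0 `|` R)] -> total_on F subset ->
    pairing (R0 `|` \bigcup_(R in F) R).
  move=> FP Ftot.
  pose G := [set R0] `|` [set R0 `|` R | R in F].
  have -> : R0 `|` \bigcup_(R in F) R = \bigcup_(R in G) R.
    apply/seteqP; split=> x.
      case=> [R0x|[R FR Rx]]; first by exists R0 => //; left.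
      by exists (R0 `|` R); [right; exists R|right].
    move=> [_ [->|[R FR <-]]]; first by left.
    by case=> [R0x|Rx]; [left|right; exists R].
  apply: pairing_bigcup; first by move=> _ [->//|[R FR <-]]; exact: FP.
  move=> _ _ [->|[R FR <-]] [->|[S FS <-]].
  - by left.
  - by left=> x; left.
  - by right=> x; left.
  - by have [RS|SR] := Ftot _ _ FR FS; [left|right]; exact: setUS.
have [R1 [R1P R1max]] := Zorn_bigcup chain.
pose R := R0 `|` R1; pose A := pairing_dom R.
have [Rsq Rtot Rfun Rinj] : pairing R by [].
have Ai n : A (i n) by apply: pairing_domS (sqR0 n); left.
have /choice[f0 Rf0] (ab : T * T) : exists c, A ab.1 -> A ab.2 -> R (ab, c).
  case: ab => a b; have [[Aa Ab]|nAab] := pselect (A a /\ A b).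
    by have [c Rabc] := Rtot a b Aa Ab; exists c.
  by exists a => Aa Ab; case: nAab.
pose f a b := f0 (a, b).
have Rf a b : A a -> A b -> R (a, b, f a b) by exact: (Rf0 (a, b)).
have Af a b : A a -> A b -> A (f a b) by move=> Aa /(Rf _ _ Aa)/Rsq[].
have finj a b a' b' : A a -> A b -> A a' -> A b' ->
    f a b = f a' b' -> a = a' /\ b = b'.
  move=> Aa Ab Aa' Ab' eqf; apply: (Rinj _ _ _ _ (f a b)); first exact: Rf.
  by rewrite eqf; exact: Rf.
have i01 : i 0 <> i 1 by move=> /iinj.
(* Two tags in A make room for two disjoint copies of A inside A. *)
have twice (B : set T) (k : T -> T) : (forall b, B b -> A (k b)) ->
    (forall b b', B b -> B b' -> k b = k b' -> b = b') ->
    exists e : T -> T, (forall a, A a \/ B a -> A (e a)) /\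
      forall a b, A a \/ B a -> A b \/ B b -> e a = e b -> a = b.
  move=> Ak kinj.
  exists (fun a => if a \in A then f (i 0) a else f (i 1) (k a)); split.
    move=> a; case: ifPn => [/set_mem Aa _|/negP nAa]; first exact: Af.
    by case=> [/mem_set//|Ba]; apply: Af => //; exact: Ak.
  move=> a b; case: ifPn => [/set_mem Aa _|/negP nAa].
    case: ifPn => [/set_mem Ab _|/negP nAb].
      by move/finj => [].
    by case=> [/mem_set//|Bb] /finj[]//; exact: (Ak _ Bb).
  case=> [/mem_set//|Ba].
  case: ifPn => [/set_mem Ab _|/negP nAb].
    by move/finj => []//; [exact: (Ak _ Ba)|move/esym/i01].
  case=> [/mem_set//|Bb] /finj[]//; [exact: (Ak _ Ba)|exact: (Ak _ Bb)|].
  by move=> _; exact: kinj.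
have [leCA|leAC] := card_le_total (~` A) A.
  have /pcard_leP/injfunPex[k kA kinj] := leCA.
  have [||e [eA einj]] := twice (~` A) k; first exact: kA.
    by move=> b b' nAb nAb'; apply: kinj; rewrite inE.
  have AorC a : A a \/ (~` A) a by exact: lem.
  exists (fun a b => f (e a) (e b)) => a b a' b' /finj[]; try exact: eA.
  by move=> /einj-> // /einj->.
(* A copy B of A outside A would be room for the pairs of A :|: B
   that are not pairs of A, against maximality. *)
have /pcard_leP/injfunPex[h hC hinj] := leAC.
pose B := h @` A.
have BnA b : B b -> ~ A b by move=> [a Aa <-]; exact: hC.
have hinj' a b : A a -> A b -> h a = h b -> a = b.
  by move=> Aa Ab; apply: hinj; rewrite inE.
have /choice[k hk] b : exists a, B b -> A a /\ h a = b.
  have [[a Aa <-]|nBb] := pselect (B b); first by exists a.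
  by exists b.
have [||e [eA einj]] := twice B k; first by move=> b /hk[].
  by move=> b b' /hk[_ {2}<-] /hk[_ {2}<-] ->.
pose new := [set x : T * T * T | [/\ A x.1.1 \/ B x.1.1, A x.1.2 \/ B x.1.2,
  ~ (A x.1.1 /\ A x.1.2) & x.2 = h (f (e x.1.1) (e x.1.2))]].
have Bnew a b c : new (a, b, c) -> B c.
  by move=> [/= ABa ABb _ ->]; exists (f (e a) (e b)) => //; apply: Af; exact: eA.
have sq : pairing_dom (R `|` new) = A `|` B.
  apply/seteqP; split=> a.
    by move=> [c [/Rsq[Aa _ _]|[/= ABa _ _ _]]]; [left|].
  case=> [Aa|Ba]; first by exists (f a a); left; exact: Rf.
  exists (h (f (e a) (e a))); right; split=> /=; [by right|by right| |by []].
  by case=> /(BnA _ Ba).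
exfalso; apply: (R1max (R1 `|` new)).
  split; first by move=> x; left.
  move=> sub; pose b := h (i 0).
  have Bb : B b by exists (i 0).
  have /BnA := Bb; apply; apply: (pairing_domS (S := R)) (_ : pairing_dom new b).
    by move=> x newx; right; apply: sub; right.
  exists (h (f (e b) (e b))); split=> /=; [by right|by right| |by []].
  by case=> /(BnA _ Bb).
rewrite /= setUA -/R; split.
- rewrite sq => a b c [/Rsq[Aa Ab Ac]|nabc]; first by split; left.
  by have [/= ABa ABb _ _] := nabc; split=> //; right; exact: Bnew nabc.
- rewrite sq => a b ABa ABb; have [[Aa Ab]|nAab] := pselect (A a /\ A b).
    by exists (f a b); left; exact: Rf.
  by exists (h (f (e a) (e b))); right.
- move=> a b c c' [Rc|nc] [Rc'|nc']; first exact: Rfun Rc Rc'.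
  + by have [Aa Ab _] := Rsq _ _ _ Rc; case: nc' => _ _ [].
  + by have [Aa Ab _] := Rsq _ _ _ Rc'; case: nc => _ _ [].
  + by case: nc => _ _ _ /= ->; case: nc' => _ _ _ /= ->.
- move=> a b a' b' c [Rc|nc] [Rc'|nc']; first exact: Rinj Rc Rc'.
  + by have [_ _ Ac] := Rsq _ _ _ Rc; case/Bnew/BnA: nc'.
  + by have [_ _ Ac] := Rsq _ _ _ Rc'; case/Bnew/BnA: nc.
  + move: nc nc' => [/= ABa ABb _ ->] [/= ABa' ABb' _].
    move=> /hinj' eq_f; have : f (e a) (e b) = f (e a') (e b').
      by apply: eq_f; apply: Af; exact: eA.
    move=> /finj[]; try exact: eA.
    by move=> /einj-> // /einj->.
Qed.

(** Finite binary trees index the antichains that are needed to turn a compatible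
    choice of conditions into a filter. *)
Inductive tree (K : Type) : Type :=
| Leaf of K
| Node of tree K & tree K.

Lemma card_le_tree (K : Type) : [set: nat] #<= [set: K] ->
  exists j : tree K -> K, injective j.
Proof.
move=> Kinf; have [f finj] := exists_pairing_function Kinf.
have [k0 [k1 k01]] : exists k0 k1 : K, k0 <> k1.
  move: Kinf finj; elim/Ppointed: K f => K f.
    move=> /card_leP[g].
    by case: (no (val (g (SigSub (mem_set (I : [set: nat] 0)))))).
  move=> /pcard_leTP/injPex[i iinj] _; exists (i 0), (i 1) => /iinj.
  by rewrite !inE => /(_ I I).
pose fix j (t : tree K) := match t with
  | Leaf k => f k0 k
  | Node l r => f k1 (f (j l) (j r))
  end.
(* k0 and k1 tag leaves and nodes *)
exists j; elim=> [k|l IHl r IHr] [k'|l' r'] /= /finj[] //.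
- by move=> _ ->.
- by move=> /esym.
- by move=> _ /finj[/IHl-> /IHr->].
Qed.

(** * Cluster points in H-closed and in compact spaces *)

Section AdjoinPoint.
Context {X : topologicalType} (F : set_system X).
Hypothesis properF : ProperFilter F.
Hypothesis openF : forall A, F A -> F A°.

(** The space [X] with one more point, whose neighbourhoods trace the
    filter [F] on [X].  The hypotheses on [F] are arguments of the type because
    the topology attached to it needs them. *)
Definition adjoin_point of ProperFilter F & (forall A, F A -> F A°) : Type :=
  option X.

Local Notation Y := (adjoin_point properF openF).

HB.instance Definition _ := Choice.copy Y (option X).

Definition adjoin_nbhs (y : Y) : set_system Y :=
  if y is Some x then Some @ nbhs x else [set A | F (Some @^-1` A) /\ A None].

Let adjoin_nbhs_filter (y : Y) : ProperFilter (adjoin_nbhs y).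
Proof.
case: y => [x|]; first exact: fmap_proper_filter.
apply: Build_ProperFilter_ex; first by move=> A [_ AN]; exists None.
split; first by split=> //; exact: filterT.
- by move=> A B [FA AN] [FB BN]; split=> //; exact: filterI.
- by move=> A B AB [FA AN]; split; [apply: filterS FA => x; exact: AB|exact: AB].
Qed.

Let adjoin_nbhs_singleton (y : Y) A : adjoin_nbhs y A -> A y.
Proof. by case: y => [x /= /nbhs_singleton//|[]]. Qed.

Let adjoin_nbhs_nbhs (y : Y) A :
  adjoin_nbhs y A -> adjoin_nbhs y (adjoin_nbhs^~ A).
Proof.
case: y => [x|[FA AN]]; first exact: nbhs_interior.
by split=> //; exact: openF FA.
Qed.

HB.instance Definition _ := hasNbhs.Build Y adjoin_nbhs.
HB.instance Definition _ := @Nbhs_isNbhsTopological.Build Y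
  adjoin_nbhs_filter adjoin_nbhs_singleton adjoin_nbhs_nbhs.

Lemma adjoin_embedding : embedding (Some : X -> Y).
Proof.
split=> [x y [] //|x A //|U oU].
exists (Some @` U : set Y).
  rewrite openE => _ [x Ux <-]; rewrite /interior /= /nbhs/=.
  apply: filterS (open_nbhs_nbhs (conj oU Ux)) => z Uz; by exists z.
by apply/seteqP; split=> [_ [x Ux <-]|_ [? _]//]; split; exists x.
Qed.

(** The absence of cluster points of [F] says exactly that the new point is
    separated from the old ones. *)
Lemma adjoin_hausdorff :
  hausdorff_space X -> cluster F = set0 -> hausdorff_space Y.
Proof.
move=> hX F0.
have far (x : X) : exists A B : set X,
      [/\ F A, nbhs x B & A `&` B = set0].
  have : ~ cluster F x by rewrite F0.
  move=> /existsNP[A /existsNP[B /not_implyP[FA /not_implyP[xB /nonemptyPn AB0]]]].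
  by exists A, B.
have sep (x : X) : ~ cluster (nbhs (None : Y)) (Some x : Y).
  have [A [B [FA xB AB0]]] := far x.
  case/(_ (Some @` A `|` [set None]) (Some @` B)).
  - by split; [apply: filterS FA => z Az; left; exists z|right].
  - by apply: (@filterS _ (nbhs x)) xB => z Bz; exists z.
  - move=> _ [[[a Aa <-]|->] [b Bb]//] [eqab].
    suff : (A `&` B) a by rewrite AB0.
    by split=> //; rewrite -eqab.
move=> [x|] [y|] // clxy.
- congr Some; apply: hX => A B xA yB.
  have [||_ [[a Aa <-] [b Bb [eqab]]]] := clxy (Some @` A) (Some @` B).
  + by apply: (@filterS _ (nbhs x)) xA => z Az; exists z.
  + by apply: (@filterS _ (nbhs y)) yB => z Bz; exists z.
  + by exists a; split=> //; rewrite -eqab.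
- case: (sep x) => A B NA xB.
  by rewrite setIC; exact: clxy.
- by case: (sep y).
Qed.

Lemma adjoin_not_closed : ~ closed (range (Some : X -> Y)).
Proof.
move=> cl; have [|x _ //] := cl (None : Y).
move=> A [/filter_ex[x Ax] _]; exists (Some x); split=> //; by exists x.
Qed.

End AdjoinPoint.

(** If [F] had no cluster point, then [X] would be embedded in the Hausdorff space
    obtained by adjoining a limit of [F], without being closed there. *)
Lemma H_closed_cluster (X : topologicalType) (F : set_system X) :
  H_closed X -> ProperFilter F -> (forall A, F A -> F A°) ->
  cluster F !=set0.
Proof.
move=> [hX closedX] PF openF; apply/set0P/eqP => F0.
apply: (@adjoin_not_closed _ _ PF openF); apply: closedX.
  exact: adjoin_hausdorff.
exact: adjoin_embedding.
Qed.

Lemma compact_H_closed (X : topologicalType) :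
  hausdorff_space X -> compact [set: X] -> H_closed X.
Proof.
move=> hX cX; split=> // Y f hY [_ cf _]; apply: compact_closed => //.
by apply: continuous_compact => //; exact: continuous_subspaceT.
Qed.

Lemma has_compact_nbhd_shrink (X : topologicalType) (x : X) (U : set X) :
  hausdorff_space X -> has_compact_nbhd x -> open U -> U x ->
  exists V, [/\ open V, V x & closure V `<=` U].
Proof.
move=> hX [N xN cN] oU Ux.
have [V xV VU] := compact_regular hX cN xN (open_nbhs_nbhs (conj oU Ux)).
exists V°; split; [exact: open_interior|exact: xV|].
by apply: subset_trans VU; apply: closureS; exact: interior_subset.
Qed.

Lemma compact_quasiregular (X : topologicalType) :
  hausdorff_space X -> compact [set: X] -> quasiregular X.
Proof.
move=> hX cX U oU [x Ux].
have xK : has_compact_nbhd x by exists setT => //; exact: filterT.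
have [V [oV Vx VU]] := has_compact_nbhd_shrink hX xK oU Ux.
by exists V; split=> //; exists x.
Qed.

(** * From posets to points of spaces *)

Section OpenPoset.
Context {X : topologicalType} (W : set X).
Hypotheses (oW : open W) (W0 : W !=set0).

(** The non-empty open subsets of [W] are the forcing conditions; [oW] and [W0]
    are arguments of the type because they make [W] its top element. *)
Definition open_poset of open W & W !=set0 : Type :=
  {V : set X | [/\ open V, V !=set0 & V `<=` W]}.

Local Notation P := (open_poset oW W0).

HB.instance Definition _ := gen_eqMixin P.
HB.instance Definition _ := gen_choiceMixin P.

Definition open_poset_le (p q : P) : bool := `[< sval p `<=` sval q >].

Let open_poset_le_refl : reflexive open_poset_le.
Proof. by move=> p; exact/asboolP. Qed.

Let open_poset_le_anti : antisymmetric open_poset_le.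
Proof.
move=> [A PA] [B PB] /andP[/asboolP /= AB /asboolP /= BA].
exact/eq_exist/seteqP.
Qed.

Let open_poset_le_trans : transitive open_poset_le.
Proof.
move=> q p r /asboolP pq /asboolP qr; apply/asboolP.
exact: subset_trans qr.
Qed.

Definition OpenPoset V (oV : open V) (V0 : V !=set0) (VW : V `<=` W) : P :=
  exist _ V (And3 oV V0 VW).

Definition open_poset_top : P := OpenPoset oW W0 (@subset_refl _ W).

HB.instance Definition _ := Order.Le_isPOrder.Build (Order.Disp tt tt) P
  open_poset_le_refl open_poset_le_anti open_poset_le_trans.

Let open_poset_lex1 (p : P) : (p <= open_poset_top)%O.
Proof. by case: p => V [oV V0 VW]; exact/asboolP. Qed.

HB.instance Definition _ := Order.hasTop.Build (Order.Disp tt tt) P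
  open_poset_lex1.

Lemma open_poset_ccc : ccc_space X -> ccc_poset P.
Proof.
move=> cccX A antiA.
have sval_inj : injective (sval : P -> set X).
  by move=> [B PB] [C PC] /= BC; exact: eq_exist.
have injA : {in A &, injective (sval : P -> set X)}.
  by move=> p q _ _; exact: sval_inj.
rewrite -(eq_countable (inj_card_eq injA)).
apply: cccX => [_ [[V [oV V0 VW]] _ <-]//|].
move=> _ _ [p Ap <-] [q Aq <-] [x [px qx]].
have [->//|pq] := pselect (p = q); case: (antiA p q Ap Aq pq).
have [[op _ pW] [oq _ _]] := (svalP p, svalP q).
have pq0 : sval p `&` sval q !=set0 by exists x.
exists (OpenPoset (openI op oq) pq0 (subset_trans (@subIsetl _ _ _) pW)).
by split; apply/asboolP => y [].
Qed.

End OpenPoset.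

(** Force with the non-empty open subsets of [W].  By the shrinking hypothesis,
    the sets [V] with [closure V `<=` U k `&` W] are dense in this poset, and
    conditions of a filter that meets them all generate a filter on [X] with an
    open base.  Any cluster point of it belongs to all closures of conditions,
    hence to [W] and to all [U k]. *)
Lemma MA_poset_point (K : Type) (X : topologicalType) (W : set X) (k0 : K) :
  MA_poset K -> ccc_space X -> open W -> W !=set0 ->
  (forall V, open V -> V !=set0 -> V `<=` W ->
    exists V', [/\ open V', V' !=set0 & closure V' `<=` V]) ->
  (forall F : set_system X, ProperFilter F -> (forall A, F A -> F A°) -> F W ->
    cluster F !=set0) ->
  forall U : K -> set X, (forall k, open (U k) /\ dense (U k)) ->
  (W `&` \bigcap_(k in [set: K]) U k) !=set0.
Proof.
move=> MA cccX oW W0 shrink cluW U Uod.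
pose P := open_poset oW W0.
pose D k : set P := [set p | closure (sval p) `<=` U k `&` W].
have Ddense k : poset_dense (D k).
  move=> [V [oV V0 VW]]; have [oU dU] := Uod k.
  have [|x|V' [oV' V'0 V'V]] := shrink (V `&` U k) (openI oV oU).
  - exact: dU.
  - by move=> [/VW].
  have subV' : V' `<=` V `&` U k by apply: subset_trans V'V; exact: subset_closure.
  have V'W : V' `<=` W by move=> x /subV'[/VW].
  exists (OpenPoset oW W0 oV' V'0 V'W); last by apply/asboolP => x /subV'[].
  by move=> x /V'V[/VW].
have [||G [[GT GI Gup] GD]] := MA _ _ (open_poset_ccc cccX) (range D).
- by move=> _ [k _ <-].
- exact: card_image_le.
pose F : set_system X := filter_from G sval.
have PF : ProperFilter F.
  apply: filter_from_proper; last by move=> [V []].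
  apply: filter_from_filter; first by exists \top%O.
  move=> p q Gp Gq; have [r [Gr /asboolP rp /asboolP rq]] := GI p q Gp Gq.
  by exists r => // x rx; split; [exact: rp|exact: rq].
have [||x] := cluW F PF.
- move=> A [p Gp pA]; exists p => // x px.
  by apply: filterS pA _; apply: open_nbhs_nbhs; split=> //; case: (svalP p).
- by exists \top%O.
rewrite clusterE => clx.
have Ux k : (U k `&` W) x.
  have [|p [Dp Gp]] := GD (D k); first by exists k.
  by apply: Dp; apply: clx; exists p.
by exists x; split=> [|k _]; [have [] := Ux k0|have [] := Ux k].
Qed.

Lemma MA_poset_H_closed (K : Type) (k0 : K) : MA_poset K -> MA_H_closed K.
Proof.
move=> MA X X0 qX HX cccX U Uod.
rewrite -[\bigcap_(_ in _) _]setTI.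
apply: (MA_poset_point k0 MA cccX openT X0) Uod => [V oV V0 _|F PF oF _].
  exact: qX.
exact: H_closed_cluster.
Qed.

(** Inside a given open set, take [W] to be open and contained in a compact set
    [N]: points of [W] have arbitrarily small closed neighbourhoods because
    compact Hausdorff spaces are regular, and filters that contain [N] have
    cluster points. *)
Lemma MA_poset_dense_compact_nbhd (K : Type) (k0 : K) :
  MA_poset K -> MA_dense_compact_nbhd K.
Proof.
move=> MA X hX cccX dX U Uod O O0 oO.
have [x [Ox [N xN cN]]] := dX O O0 oO.
pose W := O `&` N°.
have oW : open W by apply: openI => //; exact: open_interior.
have W0 : W !=set0 by exists x.
have WN : W `<=` N by move=> y [_ /interior_subset].
have [V oV [y Vy] VW|F PF oF FW|y [[Oy _] Uy]] :=
  MA_poset_point k0 MA cccX oW W0 _ _ Uod; last by exists y.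
  have yK : has_compact_nbhd y by exists N => //; case: (VW _ Vy).
  have [V' [oV' V'y V'V]] := has_compact_nbhd_shrink hX yK oV Vy.
  by exists V'; split=> //; exists y.
have [|y [_ Fy]] := cN F PF; first exact: filterS FW.
by exists y.
Qed.

(** * The compact space of maximal open filters of a poset *)

Section MaximalOpenFilters.
Context {d : Order.disp_t} {P : tPOrderType d}.
Local Open Scope order_scope.

Definition lower_set (A : set P) : Prop := forall p q : P, A p -> q <= p -> A q.

(** For the topology of lower sets, this is the exterior of [A]; a lower set
    together with its exterior is a dense open set. *)
Definition orthogonal (A : set P) : set P :=
  [set p | forall a, A a -> ~ compatible p a].

Definition down (p : P) : set P := [set q | q <= p].

Lemma lower_setI (A B : set P) :
  lower_set A -> lower_set B -> lower_set (A `&` B).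
Proof.
by move=> lA lB p q [Ap Bp] qp; split; [exact: lA qp|exact: lB qp].
Qed.

Lemma lower_orthogonal (A : set P) : lower_set (orthogonal A).
Proof.
move=> p q Ap qp a Aa [r [rq ra]]; apply: (Ap a Aa).
by exists r; split=> //; exact: le_trans qp.
Qed.

Lemma lower_down (p : P) : lower_set (down p).
Proof. by move=> q r qp rq; exact: le_trans qp. Qed.

Lemma orthogonalI0 (A : set P) : A `&` orthogonal A = set0.
Proof.
rewrite -subset0 => p [Ap /(_ p Ap)]; apply.
by exists p.
Qed.

Lemma dense_orthogonalU (A : set P) :
  lower_set A -> poset_dense (A `|` orthogonal A).
Proof.
move=> lA p; have [[a Aa [r [rp ra]]]|nA] :=
    pselect (exists2 a, A a & compatible p a).
  by exists r => //; left; exact: lA ra.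
exists p => //; right => a Aa pa; by apply: nA; exists a.
Qed.

(** The last condition expresses maximality among the proper filters of non-empty
    lower sets.  It is stated in this form since it is what ultrafilter limits
    preserve, and it makes every basic open set below clopen.  Such filters
    correspond to the ultrafilters of the regular open algebra of [P], so their
    space is its Stone space, without the algebra having to be built. *)
Definition maximal_open_filter (x : set (set P)) : Prop :=
  [/\ forall A, x A -> lower_set A /\ A !=set0,
      forall A B, x A -> x B -> x (A `&` B) &
      forall A, lower_set A -> x A \/ x (orthogonal A)].

Definition mof_space : Type := {x : set (set P) | maximal_open_filter x}.

HB.instance Definition _ := gen_eqMixin mof_space.
HB.instance Definition _ := gen_choiceMixin mof_space.

Definition basic (A : set P) : set mof_space := [set x | sval x A].

Lemma mof_orthogonal (x : mof_space) (A : set P) :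
  sval x A -> sval x (orthogonal A) -> False.
Proof.
case: x => x [x0 xI _] /= xA xA'.
have [_ [p]] := x0 _ (xI _ _ xA xA').
by rewrite orthogonalI0.
Qed.

Lemma mof_up (x : mof_space) (A B : set P) :
  lower_set B -> A `<=` B -> sval x A -> sval x B.
Proof.
move=> lB AB xA; have [x0 xI xU] := svalP x.
have [//|xB] := xU B lB; have [_ [p [Ap Bp]]] := x0 _ (xI _ _ xA xB).
suff : (B `&` orthogonal B) p by rewrite orthogonalI0.
by split=> //; exact: AB.
Qed.

Lemma mof_setT (x : mof_space) : sval x setT.
Proof.
have [x0 _ xU] := svalP x.
have [|//|xT] := xU setT; first by [].
have [_ [p /(_ p I)[]]] := x0 _ xT; by exists p.
Qed.

Definition mof_open (U : set mof_space) : Prop :=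
  forall x, U x -> exists2 A, sval x A & basic A `<=` U.

Let mof_openT : mof_open setT.
Proof. by move=> x _; exists setT => //; exact: mof_setT. Qed.

Let mof_openI : setI_closed mof_open.
Proof.
move=> U V oU oV x [Ux Vx]; have [A xA AU] := oU x Ux; have [B xB BV] := oV x Vx.
have [x0 xI _] := svalP x; exists (A `&` B); first exact: xI.
have [lA _] := x0 A xA; have [lB _] := x0 B xB.
move=> y yAB; split.
  by apply: AU; apply: mof_up lA _ yAB => p [].
by apply: BV; apply: mof_up lB _ yAB => p [].
Qed.

Let mof_open_bigU (I : Type) (f : I -> set mof_space) :
  (forall i, mof_open (f i)) -> mof_open (\bigcup_i f i).
Proof.
move=> of_ x [i _ fx]; have [A xA Af] := of_ i x fx.
by exists A => // y Ay; exists i => //; exact: Af.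
Qed.

HB.instance Definition _ :=
  isOpenTopological.Build mof_space mof_openT mof_openI mof_open_bigU.

Lemma open_basic (A : set P) : open (basic A).
Proof. by move=> x xA; exists A. Qed.

(** The dense lower sets and [down p] have the finite intersection property.  An
    ultrafilter on the set [P] that contains them all contains [A] or
    [orthogonal A] for each lower set [A], because their union is dense. *)
Lemma basic_nonempty (p : P) : basic (down p) !=set0.
Proof.
pose base := [set D | lower_set D /\ poset_dense D].
pose F : set_system P := filter_from base (fun D => D `&` down p).
have PF : ProperFilter F.
  apply: filter_from_proper; last first.
    by move=> D [_ /(_ p)[q Dq qp]]; exists q.
  apply: filter_from_filter.
    by exists setT; split=> // q; exists q.
  move=> D E [lD dD] [lE dE]; exists (D `&` E); last first.
    by move=> q [[Dq Eq] qp].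
  split; first exact: lower_setI.
  move=> q; have [r Dr rq] := dD q; have [s Es sr] := dE r.
  by exists s; [split=> //; exact: lD sr|exact: le_trans rq].
have [G [UG FG]] := ultraFilterLemma PF.
pose x := [set A : set P | lower_set A /\ G A].
have xP : maximal_open_filter x.
  split.
  - by move=> A [lA /filter_ex].
  - by move=> A B [lA GA] [lB GB]; split; [exact: lower_setI|exact: filterI].
  - move=> A lA; have GAA : G (A `|` orthogonal A).
      apply: FG; exists (A `|` orthogonal A); last by move=> q [].
      split; last exact: dense_orthogonalU.
      move=> q r [Aq|Aq] rq; first by left; exact: lA rq.
      by right; exact: lower_orthogonal rq.
    have [GA|GA] := in_ultra_setVsetC A UG; first by left.
    right; split; first exact: lower_orthogonal.
    by apply: filterS (filterI GAA GA) => q [[]].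
exists (exist _ x xP); split; first exact: lower_down.
by apply: FG; exists setT; [split=> // q; exists q|move=> q []].
Qed.

(** The sets [basic (down p)] are a pi-base of the space: this transfers density
    and chain conditions between [P] and the space. *)
Lemma open_contains_basic (U : set mof_space) :
  open U -> U !=set0 -> exists p, basic (down p) `<=` U.
Proof.
move=> oU [x Ux]; have [A xA AU] := oU x Ux; have [x0 _ _] := svalP x.
have [lA [p Ap]] := x0 A xA; exists p => y yp; apply: AU.
by apply: mof_up yp => // q qp; exact: lA qp.
Qed.

Lemma mof_hausdorff : hausdorff_space mof_space.
Proof.
move=> x y clxy.
suff sub (z t : mof_space) : cluster (nbhs z) t -> sval z `<=` sval t.
  have clyx : cluster (nbhs y) x.
    by move=> A B yA xB; rewrite setIC; exact: clxy.
  by case: x y clxy clyx => [x Px] [y Py] /sub xy /sub yx; exact/eq_exist/seteqP.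
move=> clzt A zA; have [z0 _ _] := svalP z; have [lA _] := z0 A zA.
have [_ _ tU] := svalP t; have [//|tA] := tU A lA.
have [||w [wA wA']] := clzt (basic A) (basic (orthogonal A)).
- by apply: open_nbhs_nbhs; split=> //; exact: open_basic.
- by apply: open_nbhs_nbhs; split=> //; exact: open_basic.
by case: (mof_orthogonal wA wA').
Qed.

(** The limit of an ultrafilter [F] on the space consists of the lower sets [A]
    with [F (basic A)]. *)
Lemma mof_compact : compact [set: mof_space].
Proof.
rewrite compact_ultra => F UF _.
pose x := [set A : set P | lower_set A /\ F (basic A)].
have xP : maximal_open_filter x.
  split.
  - move=> A [lA /filter_ex[y yA]]; have [y0 _ _] := svalP y.
    exact: y0.
  - move=> A B [lA FA] [lB FB]; split; first exact: lower_setI.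
    apply: filterS (filterI FA FB) => y [yA yB].
    by have [_ yI _] := svalP y; exact: yI.
  - move=> A lA; have [FA|FA] := in_ultra_setVsetC (basic A) UF; first by left.
    right; split; first exact: lower_orthogonal.
    apply: filterS FA => y nyA; have [_ _ yU] := svalP y.
    by have [yA|//] := yU A lA; case: nyA.
exists (exist _ x xP); split=> // U.
rewrite nbhsE => -[V [oV Vx] VU]; apply: filterS VU _.
have [A [lA FA] AV] := oV _ Vx; exact: filterS FA.
Qed.

(** Choosing a condition below each set of a disjoint family gives an antichain,
    since a common lower bound of two of them yields a common point. *)
Lemma mof_ccc : ccc_poset P -> ccc_space mof_space.
Proof.
move=> cccP F Fopen Ftriv.
have /choice[p pU] (U : set mof_space) : exists p, F U -> basic (down p) `<=` U.
  have [FU|nFU] := pselect (F U); last by exists \top.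
  by have [oU U0] := Fopen U FU; have [p] := open_contains_basic oU U0; exists p.
have common U V : F U -> F V -> compatible (p U) (p V) -> U = V.
  move=> FU FV [r [rU rV]]; apply: Ftriv => //.
  have [x xr] := basic_nonempty r; exists x; split.
    by apply: pU => //; apply: mof_up xr => [|q qr];
      [exact: lower_down|exact: le_trans rU].
  by apply: pU => //; apply: mof_up xr => [|q qr];
    [exact: lower_down|exact: le_trans rV].
have pinj : {in F &, injective p}.
  move=> U V /set_mem FU /set_mem FV pUV; apply: common => //.
  by rewrite pUV; exists (p V).
rewrite -(eq_countable (inj_card_eq pinj)); apply: cccP.
move=> _ _ [U FU <-] [V FV <-] neq compat; apply: neq.
by rewrite (common U V).
Qed.

(** Maximality is expressed by predensity in [P]: for a dense [D], this is the same
    as maximality among the antichains inside [D]. *)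
Definition maximal_antichain_in (D A : set P) : Prop :=
  [/\ A `<=` D, antichain A &
      forall p, exists2 a, A a & compatible p a].

Lemma exists_maximal_antichain (D : set P) :
  poset_dense D -> exists A, maximal_antichain_in D A.
Proof.
move=> dD.
have chain F : F `<=` [set A | A `<=` D /\ antichain A] -> total_on F subset ->
    \bigcup_(A in F) A `<=` D /\ antichain (\bigcup_(A in F) A).
  move=> FP Ftot; split; first by move=> p [A /FP[AD _]]; exact: AD.
  move=> p q [A FA Ap] [B FB Bq].
  have [AB|BA] := Ftot _ _ FA FB.
    by apply: (FP _ FB).2 => //; exact: AB.
  by apply: (FP _ FA).2 => //; exact: BA.
have [A [[AD antiA] Amax]] := Zorn_bigcup chain.
exists A; split=> // p; apply: contrapT => np.
have [q Dq qp] := dD p.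
have nq a : A a -> ~ compatible q a.
  move=> Aa [r [rq ra]]; apply: np; exists a => //; exists r.
  by split=> //; exact: le_trans qp.
apply: (Amax (A `|` [set q])).
  split; first by move=> a; left.
  by move=> /(_ q (or_intror erefl)) Aq; apply: (nq q Aq); exists q.
split; first by move=> a [/AD//|->].
move=> a b [Aa|->] [Ab|->] neq //; first exact: antiA.
  by case=> r [ra rq]; apply: (nq a Aa); exists r.
exact: nq.
Qed.

Definition meeting (A : set P) : set mof_space := \bigcup_(a in A) basic (down a).

Lemma open_meeting (A : set P) : open (meeting A).
Proof. by apply: bigcup_open => a _; exact: open_basic. Qed.

Lemma dense_meeting (A : set P) :
  (forall p, exists2 a, A a & compatible p a) -> dense (meeting A).
Proof.
move=> preA U U0 oU; have [p pU] := open_contains_basic oU U0.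
have [a Aa [r [rp ra]]] := preA p; have [x xr] := basic_nonempty r.
exists x; split.
  by apply: pU; apply: mof_up xr => [|q qr];
    [exact: lower_down|exact: le_trans rp].
exists a => //; apply: mof_up xr => [|q qr];
  [exact: lower_down|exact: le_trans ra].
Qed.

End MaximalOpenFilters.

(** * From compact spaces to filters on posets *)

Lemma MA_compact_injective (K T : Type) (j : T -> K) :
  injective j -> MA_compact K -> MA_compact T.
Proof.
move=> jinj MA X hX X0 cX cccX U Uod.
pose V k := [set x | forall t, j t = k -> U t x].
have Vj t : V (j t) = U t.
  by apply/seteqP; split=> [x /(_ t erefl)//|x Ux t' /jinj->].
have [|x Vx] := MA X hX X0 cX cccX V; last first.
  by exists x => t _; rewrite -Vj; exact: Vx.
move=> k; have [[t <-]|nk] := pselect (exists t, j t = k).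
  by rewrite Vj; exact: Uod.
have -> : V k = setT by apply/seteqP; split=> // x _ t jt; case: nk; exists t.
by split; [exact: openT|move=> O [x Ox] _; exists x].
Qed.

(** The default value [x0] serves when [A] is empty, and for the indices outside
    the image of the injection of [A] into [K]. *)
Lemma card_le_enum (T K : Type) (A : set T) (x0 : T) :
  A #<= [set: K] -> exists E : K -> T,
    (forall k, A (E k) \/ E k = x0) /\ forall x, A x -> exists k, E k = x.
Proof.
elim/Ppointed: K => K.
  rewrite !emptyE => A0; exists (fun=> x0).
  by split=> [k|x]; [right|rewrite A0].
move=> /pcard_leTP/injPex[j jinj].
have /choice[E EP] (k : K) : exists x,
    (A x /\ j x = k) \/ (x = x0 /\ forall y, A y -> j y <> k).
  have [[x Ax <-]|nk] := pselect (exists2 x, A x & j x = k).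
    by exists x; left.
  by exists x0; right; split=> // y Ay jy; apply: nk; exists y.
exists E; split=> [k|x Ax]; first by case: (EP k) => -[]; [left|right].
exists (j x); have [[AE jE]|[_ /(_ x Ax)//]] := EP (j x).
by apply: jinj; rewrite ?inE.
Qed.

Section Below.
Context {d : Order.disp_t} {P : tPOrderType d}.
Local Open Scope order_scope.

Definition below (A : set P) : set P := [set p | exists2 a, A a & p <= a].

Lemma dense_belowI (A B : set P) :
  (forall p, exists2 a, A a & compatible p a) ->
  (forall p, exists2 b, B b & compatible p b) ->
  poset_dense (below A `&` below B).
Proof.
move=> preA preB p; have [a Aa [r [rp ra]]] := preA p.
have [b Bb [s [sr sb]]] := preB r.
exists s; last exact: le_trans rp.
by split; [exists a => //; exact: le_trans ra|exists b].
Qed.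

End Below.

(** A maximal open filter [x] which meets the dense sets need not induce a filter
    on [P]: for [p] and [q] with [x] in [basic (down p)] and [basic (down q)], it
    need not contain [down r] for any common lower bound [r] of [p] and [q], and
    forcing this for all pairs may take more than [K] dense sets.  Only selected
    conditions are therefore considered.  A leaf [k] of a tree gets a
    maximal antichain inside the [k]-th dense set, and a tree with subtrees [l]
    and [r] gets a maximal antichain that refines those of [l] and [r].  A point
    [x] that meets all these antichains selects one element of each, and the
    element selected at a node is a lower bound of those selected at its two
    subtrees.  Hence the selected elements are a filter base. *)
Lemma MA_compact_poset (K : Type) :
  [set: nat] #<= [set: K] -> MA_compact K -> MA_poset K.
Proof.
move=> Kinf MA d P cccP DD DDdense DDK.
have [k0 _] := infinite_setN0 ((infiniteP _).2 Kinf).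
have [j jinj] := card_le_tree Kinf.
have [E [DDE EDD]] := card_le_enum setT DDK.
have Edense k : poset_dense (E k).
  by have [/DDdense//|->] := DDE k; move=> p; exists p.
have /choice[amax amaxP] (D : set P) :
    exists A, poset_dense D -> maximal_antichain_in D A.
  have [/exists_maximal_antichain[A AP]|nD] := pselect (poset_dense D).
    by exists A.
  by exists set0.
pose fix anti (t : tree K) : set P := match t with
  | Leaf k => amax (E k)
  | Node l r => amax (below (anti l) `&` below (anti r))
  end.
have antiP t : antichain (anti t) /\
    forall p, exists2 a, anti t a & compatible p a.
  elim: t => [k|l [_ prel] r [_ prer]] /=.
    by have [] := amaxP _ (Edense k).
  by have [] := amaxP _ (dense_belowI prel prer).
have node l r : anti (Node l r) `<=` below (anti l) `&` below (anti r).
  by have [] := amaxP _ (dense_belowI (antiP l).2 (antiP r).2).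
have space_nonempty : [set: @mof_space _ P] !=set0.
  by have [x _] := basic_nonempty (\top%O : P); exists x.
have meeting_open_dense t : open (meeting (anti t)) /\ dense (meeting (anti t)).
  by split; [exact: open_meeting|apply: dense_meeting; case: (antiP t)].
have [x meetx] := MA_compact_injective jinj MA (@mof_hausdorff _ P) space_nonempty
  (@mof_compact _ P) (mof_ccc cccP) meeting_open_dense.
pose sel t p := anti t p /\ basic (down p) x.
(* x contains a down-set for at most one element of an antichain, because
   members of x have non-empty intersection *)
have selE t p q : sel t p -> sel t q -> p = q.
  move=> [tp xp] [tq xq]; apply: contrapT => pq.
  apply: (antiP t).1 pq _ => //; have [x0 xI _] := svalP x.
  by have [_ [r [rp rq]]] := x0 _ (xI _ _ xp xq); exists r.
have sel_ex t : exists p, sel t p.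
  by have [p tp xp] := meetx t I; exists p.
have sel_below t p q : sel t p -> below (anti t) q -> basic (down q) x ->
    (q <= p)%O.
  move=> sp [a ta qa] xq; suff -> : p = a by [].
  apply: (selE t) => //; split=> //; apply: mof_up xq => [|r rq].
    exact: lower_down.
  exact: le_trans qa.
pose G := [set p | exists t q, sel t q /\ (q <= p)%O].
exists G; split; last first.
  move=> D /EDD[k <-]; have [p [kp xp]] := sel_ex (Leaf k).
  exists p; split; last by exists (Leaf k), p.
  by have [+ _ _] := amaxP _ (Edense k); apply.
split.
- have [p sp] := sel_ex (Leaf k0).
  by exists (Leaf k0), p; split=> //; exact: lex1.
- move=> p q [l [p' [sp pp']]] [r [q' [sq qq']]].
  have [s [ns xs]] := sel_ex (Node l r); have [ls rs] := node _ _ _ ns.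
  exists s; split.
  + by exists (Node l r), s.
  + exact: le_trans (sel_below _ _ _ sp ls xs) pp'.
  + exact: le_trans (sel_below _ _ _ sq rs xs) qq'.
- by move=> p q [t [r [sr rp]]] pq; exists t, r; split=> //; exact: le_trans pq.
Qed.

(** * The equivalences *)

Theorem theorem4p2 (K : Type)
    (K_infinite : [set: nat] #<= [set: K])
    (K_lt_continuum : card_lt [set: K] [set: set nat]) :
  [/\ MA_H_closed K <-> MA_compact K,
      MA_H_closed K <-> MA_dense_compact_nbhd K &
      MA_H_closed K <-> MA_poset K].
Proof.
have [k0 _] := infinite_setN0 ((infiniteP _).2 K_infinite).
have H41 : MA_H_closed K -> MA_compact K.
  move=> MA X hX X0 cX; apply: MA => //; first exact: compact_quasiregular.
  exact: compact_H_closed.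
have H21 : MA_dense_compact_nbhd K -> MA_compact K.
  move=> MA X hX X0 cX cccX U Uod.
  have [|x [_ Ux]] := MA X hX cccX _ U Uod _ X0 openT; last by exists x.
  move=> O [x Ox] _; exists x; split=> //.
  by exists setT => //; exact: filterT.
have H13 := MA_compact_poset K_infinite.
have H32 := MA_poset_dense_compact_nbhd k0.
have H34 := MA_poset_H_closed k0.
by split; split; auto.
Qed.
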